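(* Let $I\subset\mathbb{R}$ be a closed interval, $p\in[0,1]$, and let $f,g:I\to I$ be contractive, i.e. there exist $c_1,c_2\in(0,1)$ such that $|f(x)-f(y)|\le c_1|x-y|$ and $|g(x)-g(y)|\le c_2|x-y|$ for all $x,y\in I$. Then $\mu(f,g,p)=0$.
   Context: $I$ is a closed bounded interval of length $|I|>0$. For maps $f,g:I\to I$ and $p\in[0,1]$, consider the random dynamical system in which at each step, independently, $f$ is applied with probability $p$ and $g$ with probability $1-p$. Formally, $\Omega=\{f,g\}^{\infty}$ carries the product probability measure $P$ under which the coordinates $\omega_1,\omega_2,\ldots$ are independent with $P(\omega_i=f)=p$, $P(\omega_i=g)=1-p$ ($f$ and $g$ being treated as two distinct symbols). For $x\in I$ the trajectory is $x_0=x$, $x_n(\omega)=\omega_n\circ\omega_{n-1}\circ\cdots\circ\omega_1(x)$. For two starting points $x,y\in I$ the trajectories $x_n$ and $y_n$ are driven by the same $\omega$. Define, for $n\ge 1$ and $t\in\mathbb{R}$, $$F_{xy}^{(n)}(t)=\frac1n\sum_{i=0}^{n-1}P(|x_i-y_i|<t),\quad F_{xy}(t)=\liminf_{n\to\infty}F_{xy}^{(n)}(t),\quad F_{xy}^\star(t)=\limsup_{n\to\infty}F_{xy}^{(n)}(t),$$ and the measure of (distributional) chaos $$\mu(f,g,p)=\sup_{x,y\in I}\frac1{|I|}\int_0^{|I|}\bigl(F_{xy}^\star(t)-F_{xy}(t)\bigr)\,\mathrm{d}t .$$ *)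

(* Defs.v *)
From HB Require Import structures.
From mathcomp Require Import all_boot all_order all_algebra finmap.
From mathcomp Require Import all_classical all_reals all_analysis.

Set Implicit Arguments.
Unset Strict Implicit.
Unset Printing Implicit Defensive.

Import Order.TTheory GRing.Theory Num.Theory.
Import numFieldNormedType.Exports.

Local Open Scope classical_set_scope.
Local Open Scope ring_scope.

(* The symbols f and g are encoded by true and false respectively, so that they
   stay distinct even when the two maps coincide; [w i] is omega_(i+1). *)
Definition cylinders : set (set (nat -> bool)) :=
  [set C | exists i (A : set bool), C = [set w | A (w i)]].

(* {f,g}^oo with the product sigma-algebra *)
Definition paths := g_sigma_algebraType cylinders.

Definition independent_coordinates (R : realType) (P : probability paths R) :=
  forall (J : {fset nat}) (A : nat -> set bool),
    P (\bigcap_(j in [set` J]) [set w : paths | A j (w j)]) =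
    (\prod_(j <- J) P [set w : paths | A j (w j)])%E.

Definition is_product_measure (R : realType) (p : R) (P : probability paths R) :=
  (forall i : nat, P [set w : paths | w i = true] = p%:E /\
                   P [set w : paths | w i = false] = (1 - p)%:E) /\
  independent_coordinates P.

Definition contractive_on (R : realType) (D : set R) (f : R -> R) :=
  exists2 c : R, 0 < c < 1 &
    forall x y, D x -> D y -> `|f x - f y| <= c * `|x - y|.

Section Chaos.
Context (R : realType) (f g : R -> R) (P : probability paths R).

Fixpoint trajectory (w : paths) (x : R) (n : nat) : R :=
  if n is m.+1 then (if w m then f else g) (trajectory w x m) else x.

(* Only n >= 1 is meaningful; the value at n = 0 does not affect the limits. *)
Definition mean_dist (x y : R) (n : nat) (t : R) : \bar R :=
  ((n%:R^-1)%:E * \sum_(0 <= i < n)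
     P [set w | (`|trajectory w x i - trajectory w y i| < t)%R])%E.

Definition lower_dist (x y t : R) : \bar R :=
  limn_einf (fun n => mean_dist x y n t).

Definition upper_dist (x y t : R) : \bar R :=
  limn_esup (fun n => mean_dist x y n t).

(* The dependence on p is through the measure P. *)
Definition chaos_measure (a b : R) : \bar R :=
  ereal_sup [set (((b - a)^-1)%:E *
     \int[lebesgue_measure]_(t in `[0%R, (b - a)%R])
       (upper_dist x y t - lower_dist x y t))%E
   | x in `[a, b] & y in `[a, b]].

End Chaos.

(* Main.v *)
(** If c < 1 bounds both contraction constants, then |x_n - y_n| <= c^n |x - y|
    along every path, whatever the noise.  For t > 0 the event |x_n - y_n| < t
    is thus the whole space for large n, while for t <= 0 it is always empty.
    By Cesaro's lemma F_{xy} and F*_{xy} therefore coincide everywhere. *)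
Require Import Defs.
From HB Require Import structures.
From mathcomp Require Import all_boot all_order all_algebra finmap.
From mathcomp Require Import all_classical all_reals all_analysis.

Set Implicit Arguments.
Unset Strict Implicit.
Unset Printing Implicit Defensive.

Import Order.TTheory GRing.Theory Num.Theory.
Import numFieldNormedType.Exports.

Local Open Scope classical_set_scope.
Local Open Scope ring_scope.

Lemma measurable_coordinate (i : nat) (c : bool) :
  measurable [set w : paths | w i = c].
Proof. by apply: sub_sigma_algebra; exists i, [set c]. Qed.

(** The contraction inequalities are available on [D] only, so iterating them requires that orbits
    never leave [D]. *)
Lemma trajectory_itv (R : realType) (f g : R -> R) (D : set R) (w : paths)
    (x : R) (n : nat) :
  set_fun D D f -> set_fun D D g -> D x -> D (trajectory f g w x n).
Proof.
move=> fD gD Dx; elim: n => //= n IH.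
by case: (w n); [exact: fD | exact: gD].
Qed.

(* The event depends on the first [n] coordinates only, hence is a finite union
   of intersections of cylinders, whatever [Q] is. *)
Lemma measurable_trajectory (R : realType) (f g : R -> R) (x y : R) (n : nat)
    (Q : R -> R -> Prop) :
  measurable [set w : paths | Q (trajectory f g w x n) (trajectory f g w y n)].
Proof.
(* [Q] is generalised because the last map applied is absorbed into the relation: the induction
   hypothesis is used with [Q] precomposed with [f], then with [g]. *)
elim: n Q => /= [|n IH] Q.
  have [Qxy|nQxy] := pselect (Q x y).
    by rewrite (_ : [set _ | _] = setT)//; apply/seteqP; split.
  by rewrite (_ : [set _ | _] = set0)//; apply/seteqP; split.
rewrite (_ : [set _ | _] =
  ([set w : paths | w n = true] `&`
   [set w : paths | Q (f (trajectory f g w x n)) (f (trajectory f g w y n))]) `|`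
  ([set w : paths | w n = false] `&`
   [set w : paths | Q (g (trajectory f g w x n)) (g (trajectory f g w y n))])).
  apply: measurableU; (apply: measurableI; first exact: measurable_coordinate).
  - exact: (IH (fun u v => Q (f u) (f v))).
  - exact: (IH (fun u v => Q (g u) (g v))).
apply/seteqP; split => w /=; case: (w n).
- by left.
- by right.
- by case=> -[].
- by case=> -[].
Qed.

Lemma contractive_common (R : realType) (D : set R) (f g : R -> R) :
  contractive_on D f -> contractive_on D g ->
  exists2 c : R, 0 < c < 1 & forall x y, D x -> D y ->
    `|f x - f y| <= c * `|x - y| /\ `|g x - g y| <= c * `|x - y|.
Proof.
move=> [c1 /andP[c10 c11] fc] [c2 /andP[c20 c21] gc].
exists (Num.max c1 c2); first by rewrite lt_max c10 gt_max c11.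
move=> x y Dx Dy; split.
- by rewrite (le_trans (fc _ _ Dx Dy))// ler_wpM2r// le_max lexx.
- by rewrite (le_trans (gc _ _ Dx Dy))// ler_wpM2r// le_max lexx orbT.
Qed.

Lemma trajectory_dist (R : realType) (f g : R -> R) (D : set R) (c : R)
    (w : paths) (x y : R) (n : nat) :
  0 < c -> set_fun D D f -> set_fun D D g ->
  (forall x y, D x -> D y ->
    `|f x - f y| <= c * `|x - y| /\ `|g x - g y| <= c * `|x - y|) ->
  D x -> D y ->
  `|trajectory f g w x n - trajectory f g w y n| <= `|x - y| * c ^+ n.
Proof.
move=> c0 fD gD fgc Dx Dy; elim: n => [|n IH] /=; first by rewrite mulr1.
have Tx := trajectory_itv w n fD gD Dx; have Ty := trajectory_itv w n fD gD Dy.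
have [fle gle] := fgc _ _ Tx Ty.
rewrite exprS mulrCA.
apply: (@le_trans _ _
  (c * `|trajectory f g w x n - trajectory f g w y n|)); last first.
  by rewrite ler_wpM2l// ltW.
by case: (w n).
Qed.

Lemma probability_dist_cvg (R : realType) (P : probability paths R)
    (f g : R -> R) (D : set R) (x y t : R) :
  set_fun D D f -> set_fun D D g ->
  contractive_on D f -> contractive_on D g -> D x -> D y ->
  exists l : R,
    fine (P [set w | `|trajectory f g w x n - trajectory f g w y n| < t])
      @[n --> \oo] --> l.
Proof.
move=> fD gD fc gc Dx Dy.
have [t0|t0] := leP t 0.
  exists 0; apply: cvg_near_cst; apply: nearW => n.
  rewrite (_ : [set _ | _] = set0) ?measure0//.
  by rewrite -subset0 => w /=; rewrite ltNge (le_trans t0).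
have [c /andP[c0 c1] fgc] := contractive_common fc gc.
have cvg0 : `|x - y| * c ^+ n @[n --> \oo] --> (0 : R).
  by apply: (@cvg_geometric R `|x - y| c); rewrite gtr0_norm.
exists 1; apply: cvg_near_cst.
near=> n.
(* This threshold on [n] does not depend on the path, so the event fills the whole space at once. *)
have ct : `|x - y| * c ^+ n < t by near: n; exact: cvgr_lt cvg0 _ t0.
rewrite (_ : [set _ | _] = setT) ?probability_setT//.
apply/seteqP; split => // w _ /=.
exact: le_lt_trans (trajectory_dist w n c0 fD gD fgc Dx Dy) ct.
Unshelve. all: by end_near. Qed.

(** Brings the averages to the real-valued form expected by Cesaro's lemma. The index shifts because
    [arithmetic_mean u n] averages the [n.+1] terms from [u 0] to [u n]. *)
Lemma mean_distE (R : realType) (P : probability paths R) (f g : R -> R)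
    (x y t : R) (n : nat) :
  mean_dist f g P x y n.+1 t = (arithmetic_mean (fun i =>
    fine (P [set w | `|trajectory f g w x i - trajectory f g w y i| < t]))
    n)%:E.
Proof.
rewrite /mean_dist /arithmetic_mean /= EFinM seriesEnat /= -sumEFin.
congr (_ * _)%E; apply: eq_bigr => i _; rewrite fineK//.
(* Measurability of the event makes its probability finite, so [fine] loses nothing. *)
apply: fin_num_measure.
exact: (measurable_trajectory f g x y i (fun u v => `|u - v| < t)).
Qed.

Lemma upper_dist_lower_dist (R : realType) (P : probability paths R)
    (f g : R -> R) (D : set R) (x y t : R) :
  set_fun D D f -> set_fun D D g ->
  contractive_on D f -> contractive_on D g -> D x -> D y ->
  (upper_dist f g P x y t - lower_dist f g P x y t = 0)%E.
Proof.
move=> fD gD fc gc Dx Dy.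
have [l ul] := probability_dist_cvg P t fD gD fc gc Dx Dy.
have ml : mean_dist f g P x y n t @[n --> \oo] --> l%:E.
  (* The shift discards the term at [n = 0], which is not an average. *)
  rewrite -cvg_shiftS; under eq_fun do rewrite mean_distE.
  by apply: cvg_EFin; [exact: nearW | exact: cesaro].
have [linf lsup] := cvg_limn_einf_sup ml.
(* Both limits equal the real number [l]; its finiteness is what makes the extended difference
   vanish. *)
by rewrite /upper_dist /lower_dist linf lsup subee.
Qed.

Theorem proposition4p3 (R : realType) (a b : R) (hab : a < b)
    (p : R) (hp : 0 <= p <= 1)
    (P : probability paths R) (hP : is_product_measure p P)
    (f g : R -> R)
    (fI : set_fun `[a, b] `[a, b] f) (gI : set_fun `[a, b] `[a, b] g)
    (fc : contractive_on `[a, b] f) (gc : contractive_on `[a, b] g) :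
  chaos_measure f g P a b = 0%E.
Proof.
have int0 x y : `[a, b]%classic x -> `[a, b]%classic y ->
    (((b - a)^-1)%:E * \int[lebesgue_measure]_(t in `[0%R, (b - a)%R])
       (upper_dist f g P x y t - lower_dist f g P x y t) = 0)%E.
  move=> Ix Iy; rewrite integral0_eq ?mule0// => t _.
  exact: (upper_dist_lower_dist P t fI gI fc gc Ix Iy).
(* A point of the interval is needed: the supremum of an empty family would be minus infinity
   instead of 0. *)
have Ia : `[a, b]%classic a by rewrite /= in_itv /= lexx ltW.
rewrite /chaos_measure (_ : [set _ | _ in _ & _ in _] = [set 0%E]) ?ereal_sup1//.
apply/seteqP; split => [z [x Ix [y Iy <-]]|_ ->]; first exact: int0.
by exists a => //; exists a => //; exact: int0.
Qed.
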